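(* Let $\xi$ be an approximate design whose information matrix $\mathbf{M}(\xi)$ is non-singular. Then the G-criterion for the prediction of individual parameters, $\Phi_G(\xi)=\max_{x\in\mathcal{X}}\sum_{i=1}^n\mathbf{f}(x)^\top\,\mathrm{MSE}(\xi)_{ii}\,\mathbf{f}(x)$, is given by $$\Phi_G(\xi)=\max_{x\in\mathcal{X}}\left(\mathbf{f}(x)^\top\left(\mathbf{M}(\xi)^{-1}+(n-1)\left(\mathbf{M}(\xi)+\mathbf{\Delta}^{-1}\right)^{-1}\right)\mathbf{f}(x)\right).$$
   Context: Random coefficients regression model: $Y_{ij}=\mathbf{f}(x_j)^\top\boldsymbol{\beta}_i+\varepsilon_{ij}$, $j=1,\dots,m$, $i=1,\dots,n$, with $m,n\ge 1$, experimental region $\mathcal{X}$, known regression functions $\mathbf{f}=(f_1,\dots,f_p)^\top:\mathcal{X}\to\mathbb{R}^p$, uncorrelated zero-mean errors of variance $\sigma^2>0$, and individual parameters $\boldsymbol{\beta}_i$ with unknown mean and $\mathrm{Cov}(\boldsymbol{\beta}_i)=\sigma^2\mathbf{D}$, where $\mathbf{D}$ is a known (symmetric) positive definite $p\times p$ matrix. Put $\mathbf{\Delta}=m\,\mathbf{D}$. An approximate design $\xi$ consists of finitely many distinct points $x_1,\dots,x_k\in\mathcal{X}$ with weights $w_j\ge 0$, $\sum_{j=1}^k w_j=1$. Its (fixed effects, standardized) information matrix is $\mathbf{M}(\xi)=\sum_{j=1}^k w_j\,\mathbf{f}(x_j)\mathbf{f}(x_j)^\top$, assumed non-singular. The (standardized)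 mean squared error matrix for the best linear unbiased prediction of $(\boldsymbol{\beta}_1^\top,\dots,\boldsymbol{\beta}_n^\top)^\top$ is the $np\times np$ matrix $$\mathrm{MSE}(\xi)=\tfrac1n\left(\mathbf{1}_n\mathbf{1}_n^\top\right)\otimes\mathbf{M}(\xi)^{-1}+\left(\mathbf{I}_n-\tfrac1n\mathbf{1}_n\mathbf{1}_n^\top\right)\otimes\left(\mathbf{M}(\xi)+\mathbf{\Delta}^{-1}\right)^{-1},$$ where $\mathbf{1}_n$ is the all-ones vector of length $n$, $\mathbf{I}_n$ the identity matrix, and $\otimes$ the Kronecker product. $\mathrm{MSE}(\xi)_{ii}$ denotes its $i$-th $p\times p$ diagonal block. For exact designs the G-criterion is $\max_{x\in\mathcal{X}}\sum_{i=1}^n\mathrm{E}\left(\left(\mathbf{f}(x)^\top(\hat{\boldsymbol{\beta}}_i-\boldsymbol{\beta}_i)\right)^2\right)$, with $\hat{\boldsymbol{\beta}}_i$ the best linear unbiased predictor of $\boldsymbol{\beta}_i$; it is extended to approximate designs by replacing $\mathrm{E}\left((\hat{\boldsymbol{\beta}}_i-\boldsymbol{\beta}_i)(\hat{\boldsymbol{\beta}}_i-\boldsymbol{\beta}_i)^\top\right)$ by $\mathrm{MSE}(\xi)_{ii}$ (the constant factor $\sigma^2/m$ being dropped), which gives the definition of $\Phi_G(\xi)$ in the claim; equivalently, $\Phi_G(\xi)=\max_{x\in\mathcal{X}}\mathrm{tr}\left(\mathrm{MSE}(\xi)\left(\mathbf{I}_n\otimes(\mathbf{f}(x)\mathbf{f}(x)^\top)\right)\right)$.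 Maxima over $\mathcal{X}$ are understood as suprema in $[0,\infty]$ if not attained. *)

(* Defs.v *)
From HB Require Import structures.
From mathcomp Require Import all_boot all_order all_algebra.
From mathcomp Require Import mxtens.
From mathcomp Require Import boolp classical_sets reals constructive_ereal ereal.
Set Implicit Arguments.
Unset Strict Implicit.
Unset Printing Implicit Defensive.
Import Order.TTheory GRing.Theory Num.Theory.
Local Open Scope ring_scope.

Record approx_design (R : realType) (X : Type) := ApproxDesign {
  design_size : nat;
  design_point : 'I_design_size -> X;
  design_weight : 'I_design_size -> R;
  design_point_inj : injective design_point;
  design_weight_ge0 : forall j, 0 <= design_weight j;
  design_weight_sum1 : \sum_(j < design_size) design_weight j = 1 }.

Arguments design_point {R X} xi j : rename.
Arguments design_weight {R X} xi j : rename.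

Definition quad_form (R : realType) (p : nat) (A : 'M[R]_p) (v : 'cV[R]_p) : R :=
  (v^T *m A *m v) 0 0.

Definition sym_posdef (R : realType) (p : nat) (D : 'M[R]_p) : Prop :=
  D^T = D /\ forall v : 'cV[R]_p, v != 0 -> 0 < quad_form D v.

(* The regression functions (f_1, ..., f_p) form one column-valued map f. *)
Definition info_mx (R : realType) (X : Type) (p : nat) (f : X -> 'cV[R]_p)
    (xi : approx_design R X) : 'M[R]_p :=
  \sum_(j < design_size xi)
    design_weight xi j *: (f (design_point xi j) *m (f (design_point xi j))^T).

Definition Delta_mx (R : realType) (p m : nat) (D : 'M[R]_p) : 'M[R]_p :=
  m%:R *: D.

Definition ones (R : realType) (n : nat) : 'cV[R]_n := const_mx 1.

(* Standardized MSE matrix, up to the factor sigma^2 / m, of the best linear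
   unbiased prediction of all n individual parameters; *t is the Kronecker
   product. *)
Definition MSE_mx (R : realType) (X : Type) (p m n : nat) (f : X -> 'cV[R]_p)
    (D : 'M[R]_p) (xi : approx_design R X) : 'M[R]_(n * p) :=
  (n%:R^-1 *: (ones R n *m (ones R n)^T)) *t invmx (info_mx f xi)
  + (1%:M - n%:R^-1 *: (ones R n *m (ones R n)^T))
      *t invmx (info_mx f xi + invmx (Delta_mx m D)).

(* [mxtens_index (i, a)] is the index [i * p + a]. *)
Definition diag_block (R : realType) (n p : nat) (A : 'M[R]_(n * p))
    (i : 'I_n) : 'M[R]_p :=
  \matrix_(a < p, b < p) A (mxtens_index (i, a)) (mxtens_index (i, b)).

(* The maximum over the experimental region, read as a supremum, possibly +oo;
   X is inhabited as soon as a design on it exists. *)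
Definition max_over (R : realType) (X : Type) (g : X -> R) : \bar R :=
  ereal_sup [set (g x)%:E | x in [set: X]].

Definition Phi_G (R : realType) (X : Type) (p m n : nat) (f : X -> 'cV[R]_p)
    (D : 'M[R]_p) (xi : approx_design R X) : \bar R :=
  max_over (fun x : X =>
    \sum_(i < n) quad_form (diag_block (MSE_mx m n f D xi) i) (f x)).

(* Main.v *)
Require Import Defs.
From HB Require Import structures.
From mathcomp Require Import all_boot all_order all_algebra.
From mathcomp Require Import mxtens.
From mathcomp Require Import boolp classical_sets reals constructive_ereal ereal.
Import Order.TTheory GRing.Theory Num.Theory.
Local Open Scope ring_scope.

(** The identity holds for each x, before any supremum. A quadratic form is linear in its matrix, so
    the sum over i only sees the sum of the diagonal blocks ([sum_quad_form]). The i-th diagonal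
    block of a Kronecker product of A and B is A_ii B, so these blocks add up to tr(A) B. In the MSE
    matrix the left factors are the projection onto the span of the all-ones vector and its
    complement, of traces 1 and n - 1 ([sum_diag_block_MSE]). *)

Lemma ones_mul_tr (R : realType) (n : nat) :
  ones R n *m (ones R n)^T = const_mx 1.
Proof. by apply/matrixP => i j; rewrite mxE big_ord1 !mxE mulr1. Qed.

Lemma sum_quad_form (R : realType) (p n : nat) (A : 'I_n -> 'M[R]_p)
    (v : 'cV[R]_p) :
  \sum_(i < n) quad_form (A i) v = quad_form (\sum_(i < n) A i) v.
Proof. by rewrite /quad_form mulmx_sumr mulmx_suml summxE. Qed.

(** The coefficients are the (i, i) entries of the two left Kronecker factors; they are the same for
    every i. *)
Lemma diag_block_MSE (R : realType) (X : Type) (p m n : nat)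
    (f : X -> 'cV[R]_p) (D : 'M[R]_p) (xi : approx_design R X) (i : 'I_n) :
  diag_block (MSE_mx m n f D xi) i =
  n%:R^-1 *: invmx (info_mx f xi)
  + (1 - n%:R^-1) *: invmx (info_mx f xi + invmx (Delta_mx m D)).
Proof.
apply/matrixP => a b; rewrite /MSE_mx ones_mul_tr.
by rewrite !mxE !mxtens_indexK /= eqxx mulr1.
Qed.

Lemma sum_diag_block_MSE (R : realType) (X : Type) (p m n : nat)
    (f : X -> 'cV[R]_p) (D : 'M[R]_p) (xi : approx_design R X) :
  (0 < n)%N ->
  \sum_(i < n) diag_block (MSE_mx m n f D xi) i =
  invmx (info_mx f xi)
  + (n%:R - 1) *: invmx (info_mx f xi + invmx (Delta_mx m D)).
Proof.
move=> n_gt0; have n_neq0 : n%:R != 0 :> R by rewrite pnatr_eq0 -lt0n.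
under eq_bigr do rewrite diag_block_MSE.
(* The summand is now free of i: n equal copies turn 1/n into 1 and 1 - 1/n into n - 1, as n is
   nonzero in R. *)
rewrite sumr_const card_ord -scaler_nat scalerDr !scalerA mulrBr mulr1.
by rewrite mulfV // scale1r.
Qed.

Theorem theorem3 (R : realType) (X : Type) (p m n : nat)
    (m_ge1 : (1 <= m)%N) (n_ge1 : (1 <= n)%N)
    (f : X -> 'cV[R]_p) (D : 'M[R]_p) (D_pd : sym_posdef D)
    (xi : approx_design R X) (M_nonsing : info_mx f xi \in unitmx) :
  Phi_G m n f D xi =
  max_over (fun x : X =>
    quad_form (invmx (info_mx f xi)
               + (n%:R - 1) *: invmx (info_mx f xi + invmx (Delta_mx m D)))
      (f x)).
Proof.
congr max_over; apply/funext => x.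
by rewrite sum_quad_form sum_diag_block_MSE.
Qed.
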